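(* Let $Y\subseteq\mathbb{R}$ and let $f:[0,1]\times Y\to\mathbb{R}$ be a function which is continuous with respect to the second variable $y$ (i.e. $y\mapsto f(x,y)$ is continuous on $Y$ for every $x\in[0,1]$), such that the second partial derivative $f''_{xx}$ exists at every point of $[0,1]\times Y$ and $$\sup_{y\in Y}\int_0^1 \bigl(f''_{xx}(x,y)\bigr)^2\,dx<\infty.$$ Then $f'_x$ is jointly continuous on $[0,1]\times Y$.
   Context: Derivatives are finite and pointwise (one-sided at the endpoints of $[0,1]$); $f'_x$ and $f''_{xx}$ are the first and second derivatives of $x\mapsto f(x,y)$ for fixed $y$. Integrals are Lebesgue integrals. $Y$ carries the subspace topology from $\mathbb{R}$, and jointly continuous means continuous as a function on $[0,1]\times Y\subseteq\mathbb{R}^2$. *)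

(* Defs.v *)
From HB Require Import structures.
From mathcomp Require Import all_boot all_order all_algebra.
From mathcomp Require Import all_classical all_reals all_analysis.
Set Implicit Arguments.
Unset Strict Implicit.
Unset Printing Implicit Defensive.
Import Order.TTheory GRing.Theory Num.Theory.
Import numFieldNormedType.Exports.
Local Open Scope classical_set_scope.
Local Open Scope ring_scope.

(* [t] tends to [x] inside [D `\ x]: for [D] a closed interval this is the
   two-sided derivative at an interior point and the one-sided derivative at an
   endpoint, and it ignores the values of [g] outside [D].  The limit is taken
   in [R], hence finite. *)
Definition diff_quotient (R : realType) (g : R -> R) (x t : R) : R :=
  (g t - g x) / (t - x).

Definition derivable_in (R : realType) (D : set R) (g : R -> R) (x : R) : Prop :=
  cvg (diff_quotient g x @ within D x^').

(* Meaningful only under [derivable_in D g x]; [lim] is total. *)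
Definition derive_in (R : realType) (D : set R) (g : R -> R) (x : R) : R :=
  lim (diff_quotient g x @ within D x^').

(* A function on [0, 1] x Y is represented by a total [f : R -> R -> R] whose
   values elsewhere are irrelevant. *)
Definition partial_x (R : realType) (f : R -> R -> R) : R -> R -> R :=
  fun x y => derive_in `[0, 1] (f ^~ y) x.

Definition partial_xx (R : realType) (f : R -> R -> R) : R -> R -> R :=
  partial_x (partial_x f).

Definition partial_x_exists (R : realType) (f : R -> R -> R) (x y : R) : Prop :=
  derivable_in `[0, 1] (f ^~ y) x.

(* At a point (x, y), the second derivative presupposes the first derivative on
   all of [0, 1] x {y}. *)
Definition partial_xx_exists (R : realType) (f : R -> R -> R) (x y : R) : Prop :=
  (forall t, t \in `[0, 1] -> partial_x_exists f t y) /\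
  partial_x_exists (partial_x f) x y.

(* Main.v *)
Require Import Defs.
From HB Require Import structures.
From mathcomp Require Import all_boot all_order all_algebra.
From mathcomp Require Import all_classical all_reals all_analysis.
From mathcomp Require Import measurable_realfun ring lra.
Set Implicit Arguments.
Unset Strict Implicit.
Unset Printing Implicit Defensive.
Import Order.TTheory GRing.Theory Num.Theory.
Import numFieldNormedType.Exports.
Local Open Scope classical_set_scope.
Local Open Scope ring_scope.

(* For fixed [y] put [h = f'_x(., y)].  Although [h'] is only assumed to exist
   pointwise with [h'^2] integrable, [|h t - h x| <= \int_x^t |h'|]: by outer
   regularity the majorant [u] of [|h'|] lies below some [v] that is locally
   bounded below by a constant [> u], with [\int v <= \int u + e], and a sup
   argument compares [h] with the indefinite integral of [v].  Majorizing [|h'|]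
   by [c / 2 + h'^2 / (2 c)] makes [f'_x(., y)] equicontinuous in [y], so near
   [x0] it is uniformly close to a difference quotient of [f(., y)], which is
   continuous in [y]. *)

Section PointwiseDerivative.
Context {R : realType}.
Notation mu := (@lebesgue_measure R).

(** * Bounding an increment by the integral of a majorant *)

(** Around each point [v >= K], so [K * |t - x|] is at most the integral of [v] between [x] and [t].
    Such bounds add up over adjacent intervals, and a supremum argument carries them from [a] to
    [b]. *)
Lemma increment_le_integral_local (a b : R) (h : R -> R) (v : R -> \bar R) :
    a <= b -> measurable_fun [set: R] v -> (forall x, 0 <= v x)%E ->
    (forall x, x \in `[a, b] -> exists2 K : R, 0 <= K &
      \forall t \near x, (K%:E <= v t)%E /\
        (t \in `[a, b] -> `|h t - h x| <= K * `|t - x|)) ->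
  (`|h b - h a|%:E <= \int[mu]_(x in `[a, b]) v x)%E.
Proof.
move=> ab mv v0 hv.
have mvS A : measurable_fun A v by exact: measurable_funTS.
(* Half-open intervals make concatenation a disjoint union. *)
pose I x y := (\int[mu]_(z in `]x, y]) v z)%E.
have Icat x y z : x <= y -> y <= z -> I x z = (I x y + I y z)%E.
  move=> xy yz; rewrite /I -ge0_integral_setU//.
    by rewrite -itv_bndbnd_setU.
    exact: mvS.
  apply/disj_set2P; rewrite -subset0 => t [] /=.
  by rewrite !in_itv/= => /andP[_ +] /andP[]; case: leP.
have Icst K x y : 0 <= K -> x <= y ->
    (forall z, x <= z <= y -> (K%:E <= v z)%E) -> ((K * (y - x))%:E <= I x y)%E.
  move=> K0 xy Kv.
  have -> : (K * (y - x))%:E = (\int[mu]_(z in `]x, y]) cst K%:E z)%E.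
    rewrite integral_cst//= lebesgue_measure_itv/= lte_fin.
    by case: ltgtP xy => // -> _; rewrite subrr mulr0 mule0.
  apply: ge0_le_integral => //=; first exact: mvS.
  move=> z; rewrite in_itv/= => /andP[xz zy].
  by apply: Kv; rewrite zy ltW.
have hI x y z : x <= y -> y <= z -> (`|h y - h x|%:E <= I x y)%E ->
    (`|h z - h y|%:E <= I y z)%E -> (`|h z - h x|%:E <= I x z)%E.
  move=> xy yz hxy hyz; rewrite (Icat _ y)//.
  rewrite (le_trans _ (leeD hxy hyz))// -EFinD lee_fin [leRHS]addrC.
  exact: ler_distD.
have loc x : x \in `[a, b] -> exists2 e, 0 < e & forall t, t \in `[a, b] ->
    `|x - t| < e -> (t <= x -> (`|h x - h t|%:E <= I t x)%E) /\
                    (x <= t -> (`|h t - h x|%:E <= I x t)%E).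
  move=> xab; have [K K0 /nbhs_ballP[e /= e0 He]] := hv x xab.
  exists e => // t tab xte.
  have [_ /(_ tab) ht] := He t xte.
  split=> [tx|xt].
    rewrite (le_trans _ (Icst K _ _ _ tx _))//.
      by rewrite lee_fin distrC (le_trans ht)// distrC ger0_norm ?subr_ge0.
    move=> z /andP[tz zx]; have [] // := He z.
    rewrite /ball/= ger0_norm ?subr_ge0//.
    by move: xte; rewrite ger0_norm ?subr_ge0//; apply: le_lt_trans; rewrite lerB.
  rewrite (le_trans _ (Icst K _ _ _ xt _))//.
    by rewrite lee_fin (le_trans ht)// ger0_norm ?subr_ge0.
  move=> z /andP[xz zt]; have [] // := He z.
  rewrite /ball/= distrC ger0_norm ?subr_ge0//.
  by move: xte; rewrite distrC ger0_norm ?subr_ge0//; apply: le_lt_trans; rewrite lerB.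
pose S := [set x | x \in `[a, b] /\ (`|h x - h a|%:E <= I a x)%E].
have Sa : S a.
  split; first by rewrite in_itv/= lexx.
  by rewrite subrr normr0 integral_ge0.
have ubS : ubound S b by move=> x [] /[!in_itv]/= /andP[].
have supS : has_sup S by split; [exists a|exists b].
have sab : sup S \in `[a, b].
  by rewrite in_itv/= ub_le_sup ?ge_sup//; [exists a|exists b].
have [e e0 He] := loc _ sab.
(* The supremum is attained: the left half of [He] joins it to a point of [S] closer than [e]. *)
have Ss : S (sup S).
  have [t St st] := sup_adherent e0 supS.
  have ts : t <= sup S by apply: ub_le_sup => //; exists b.
  split=> //; have [tab hta] := St.
  move: (tab); rewrite in_itv/= => /andP[at_ tb].
  apply: (hI _ t) => //.
  have [|+ _] := He t tab; last exact.
  by rewrite ger0_norm ?subr_ge0// ltrBlDr -ltrBlDl.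
(* If [sup S < b], the right half of [He] would put a point beyond [sup S] into [S]. *)
have sb : sup S = b.
  apply/eqP; rewrite eq_le ge_sup//=; last by exists a.
  rewrite leNgt; apply/negP => sltb.
  pose t := Num.min b (sup S + e / 2).
  have st : sup S < t by rewrite lt_min sltb ltrDl divr_gt0.
  have tb : t <= b by rewrite ge_min lexx.
  have tse : t <= sup S + e / 2 by rewrite ge_min lexx orbT.
  move: (sab); rewrite in_itv/= => /andP[as_ _].
  have tab : t \in `[a, b] by rewrite in_itv/= tb andbT (le_trans as_)// ltW.
  suff /(ub_le_sup (ex_intro _ b ubS)) : S t by rewrite leNgt st.
  split=> //; have [_ hs] := Ss; apply: (hI _ (sup S)) => //; first exact: ltW.
  have [|_] := He t tab; last by apply; exact: ltW.
  rewrite distrC ger0_norm ?subr_ge0 ?(ltW st)//; lra.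
have [_] := Ss; rewrite sb => /le_trans; apply.
by apply: ge0_subset_integral => //; [exact: mvS|exact: subset_itv_oc_cc].
Qed.

(** A Vitali-Caratheodory type construction: [v] is a series of constants carried by open
    neighbourhoods of the level sets of [u]. Openness gives the local lower bound, and outer
    regularity controls the excess of the integral. *)
Lemma lower_semicontinuous_majorant (D : set R) (u : R -> R) (e : R) :
    measurable D -> (mu D < +oo)%E -> measurable_fun D u ->
    (forall x, D x -> 0 <= u x) -> 0 < e ->
  exists v : R -> \bar R,
    [/\ measurable_fun [set: R] v, forall x, (0 <= v x)%E,
        forall x, D x -> exists2 K : R, u x < K & \forall t \near x, (K%:E <= v t)%E
      & (\int[mu]_(x in D) v x <= \int[mu]_(x in D) (u x)%:E + e%:E)%E].
Proof.
move=> mD Doo mfu u0 e0.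
have e2 : 0 < e / 2 by rewrite divr_gt0.
have muDfin : mu D \is a fin_num by rewrite ge0_fin_numE.
pose m := fine (mu D).
have m0 : 0 <= m by rewrite fine_ge0.
have muDE : mu D = m%:E by rewrite fineK.
(* [D] is cut into the level sets [E n] on which [n r <= u < (n + 1) r]; an open
   [U n] containing [E n] carries the constant [k n = (n + 1) r]. *)
pose r := e / 2 / (m + 1).
have r0 : 0 < r by rewrite divr_gt0// ltr_wpDl.
(* Rounding [u] up by [r] costs at most half of [e]; the [+ 1] in [r] allows for [mu D = 0]. *)
have rm : r * m <= e / 2.
  by rewrite /r mulrAC ler_pdivrMr ?ltr_wpDl// ler_wpM2l ?ltW// ltrDl.
pose k n : R := n.+1%:R * r.
have k0 n : 0 < k n by rewrite mulr_gt0.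
pose E n := D `&` u @^-1` `[n%:R * r, k n[.
have mE n : measurable (E n) by apply: mfu.
have EE x : D x -> E (Num.truncn (u x / r)) x.
  move=> Dx; split=> //=; rewrite in_itv/= -ler_pdivlMr// -ltr_pdivrMr//.
  by apply: truncn_itv; rewrite divr_ge0 ?u0// ltW.
have Ek n x : E n x -> n%:R * r <= u x < k n by case=> _ /=; rewrite in_itv.
(* Dividing by the weight [k n] leaves a weighted excess of at most [e / 2 / 2 ^ n.+1], and these
   sum to [e / 2]. *)
have EU n : exists U : set R, [/\ open U, E n `<=` U &
    (mu (U `\` E n) < (e / 2 / (2 ^ n.+1)%:R / k n)%:E)%E].
  apply: lebesgue_regularity_outer => //.
    apply: le_lt_trans Doo.
    by apply: le_measure; rewrite ?inE//; [exact: mE|exact: subIsetl].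
  by rewrite !divr_gt0// ltr0n expn_gt0.
have [U HU] := choice EU.
have oU n : open (U n) by have [] := HU n.
have EsU n : E n `<=` U n by have [] := HU n.
have mU n : measurable (U n) by exact: open_measurable.
pose w n x : \bar R := (k n * \1_(U n) x)%:E.
have w0 n x : (0 <= w n x)%E by rewrite lee_fin mulr_ge0 ?(ltW (k0 n)).
have mw n (A : set R) : measurable_fun A (w n).
  by apply/measurable_EFinP; apply: measurable_funM => //; exact: measurable_indic.
exists (fun x => \sum_(n <oo) w n x)%E; split.
- exact: (@ge0_emeasurable_sum _ _ _ _ _ xpredT).
- by move=> x; exact: nneseries_ge0.
- move=> x Dx; set n := Num.truncn (u x / r).
  exists (k n); first by have /andP[] := Ek _ _ (EE _ Dx).
  have /filterS : nbhs x (U n) by apply: open_nbhs_nbhs; split=> //; exact/EsU/EE.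
  apply=> t Ut.
  have := @nneseries_lim_ge _ (w^~ t) xpredT 0 n.+1 (fun i _ _ => w0 i t).
  apply: le_trans; rewrite big_nat_recr//= {2}/w indicE mem_set// mulr1.
  by rewrite leeDr// sume_ge0.
have trE : trivIset setT E.
  apply: ltn_trivIset => i j ij; rewrite -subset0 => x [].
  move=> /Ek /andP[_ +] /Ek /andP[+ _] => /le_lt_trans /[apply].
  by rewrite /k ltr_pM2r// ltr_nat ltnS leqNgt ij.
have DE : D = \bigcup_n E n.
  by apply/seteqP; split=> [x /EE xE|x [n _ []]//]; exists (Num.truncn (u x / r)).
have ur0 x : D x -> (0 <= (u x + r)%:E)%E.
  by move=> /u0 ux0; rewrite lee_fin addr_ge0 ?(ltW r0).
have mur : measurable_fun D (fun x => (u x + r)%:E).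
  by apply/measurable_EFinP; exact: measurable_funD.
pose I n := (\int[mu]_(x in E n) (u x + r)%:E)%E.
have I0 n : (0 <= I n)%E by apply: integral_ge0 => x [Dx _]; exact: ur0.
(* On [E n] the weight [k n] is at most [u + r]; the rest of [U n] contributes the second term. *)
have wI n : (\int[mu]_(x in D) w n x <= I n + (e / 2 / (2 ^ n.+1)%:R)%:E)%E.
  under eq_integral do rewrite /w EFinM.
  rewrite ge0_integralZl//=; first last.
  - by rewrite lee_fin ltW.
  - by apply/measurable_EFinP; exact: (measurable_indic (mU n)).
  rewrite integral_indic//; last exact: mU.
  have muUD : (mu (U n `&` D) <= mu (E n) + (e / 2 / (2 ^ n.+1)%:R / k n)%:E)%E.
    have [_ _ /ltW hU] := HU n.
    apply: (@le_trans _ _ (mu (U n))); first by apply: measureIl => //; exact: mU.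
    rewrite (measureDI mu (mU n) (mE n)) addeC.
    by rewrite leeD//; apply: measureIr; [exact: mU|exact: mE].
  apply: le_trans (lee_wpmul2l _ muUD) _; first by rewrite lee_fin ltW.
  rewrite ge0_muleDr// ?lee_fin ?divr_ge0 ?(ltW e0) ?(ltW (k0 n))//.
  rewrite -EFinM mulrCA mulfV ?gt_eqF// mulr1 leeD2r//.
  rewrite -integral_cst//; last exact: mE.
  apply: ge0_le_integral => //=.
  - exact: mE.
  - by move=> x _; rewrite lee_fin ltW.
  - by apply: measurable_funS mur => // x [].
  - move=> x /Ek /andP[nu _]; rewrite lee_fin /k -natr1 mulrDl mul1r.
    by rewrite lerD2r.
rewrite integral_nneseries//; last by move=> n; exact: mw.
apply: le_trans (lee_nneseries _ (fun n _ => wI n)) _.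
  by move=> n _ _; exact: integral_ge0.
apply: le_trans (epsilon_trick xpredT I0 (ltW e2)) _.
rewrite /I -ge0_integral_bigcup -?DE//.
under eq_integral do rewrite EFinD.
rewrite ge0_integralD//; last 2 first.
  by apply/measurable_EFinP.
  by move=> x _; rewrite lee_fin ltW.
have -> : (\int[mu]_(x in D) r%:E = (r * m)%:E)%E.
  by rewrite (integral_cst mu mD r%:E) [RHS]EFinM -muDE.
by rewrite -addeA leeD2l// -EFinD lee_fin; lra.
Qed.

(** Any [K > u x] is a Lipschitz bound at [x], but [u] may drop below [K] arbitrarily close to [x].
    Passing to [v] yields a [K] that is also a lower bound nearby, at the price of an arbitrary
    [e]. *)
Lemma increment_le_integral (a b : R) (h u : R -> R) :
    a <= b -> measurable_fun `[a, b] u ->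
    (forall x, x \in `[a, b] -> 0 <= u x) ->
    (forall x K, x \in `[a, b] -> u x < K ->
      \forall t \near x, t \in `[a, b] -> `|h t - h x| <= K * `|t - x|) ->
  (`|h b - h a|%:E <= \int[mu]_(x in `[a, b]) (u x)%:E)%E.
Proof.
move=> ab mfu u0 hu; apply/lee_addgt0Pr => e e0.
have muoo : (mu `[a, b]%classic < +oo)%E.
  by rewrite lebesgue_measure_itv/=; case: ifPn; rewrite ltry.
have [|v [mv v0 uv]] := lower_semicontinuous_majorant _ muoo mfu u0 e0; first by [].
apply: le_trans; apply: increment_le_integral_local => // x xab.
have [K uK vK] := uv x xab; exists K; first exact: le_trans (u0 x xab) (ltW uK).
by near=> t; split; near: t; [exact: vK|exact: hu].
Unshelve. all: by end_near. Qed.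

(** * Derivatives within a set: local estimates and measurability *)

Lemma derive_in_near (D : set R) (g : R -> R) (x e : R) :
    derivable_in D g x -> 0 < e ->
  \forall t \near x, D t -> `|g t - g x - derive_in D g x * (t - x)| <= e * `|t - x|.
Proof.
move=> dg e0.
have /cvgrPdistC_le/(_ e e0) : diff_quotient g x @ within D x^' --> derive_in D g x by [].
rewrite near_withinE => He.
have {}He : \forall t \near x, t != x -> D t ->
  `|diff_quotient g x t - derive_in D g x| <= e := He.
near=> t => Dt.
have [->|tx] := eqVneq t x; first by rewrite !subrr mulr0 subrr normr0 mulr0.
have : `|diff_quotient g x t - derive_in D g x| <= e.
  by move: Dt tx; near: t; apply: filterS He => t + Dt tx; exact.
rewrite /diff_quotient -(ler_pM2r (x := `|t - x|)) ?normr_gt0 ?subr_eq0//.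
by rewrite -normrM mulrBl divfK// subr_eq0.
Unshelve. all: by end_near. Qed.

Lemma derive_in_lipschitz_near (D : set R) (g : R -> R) (x K : R) :
    derivable_in D g x -> `|derive_in D g x| < K ->
  \forall t \near x, D t -> `|g t - g x| <= K * `|t - x|.
Proof.
rewrite -subr_gt0 => dg LK; have := derive_in_near dg LK.
apply: filterS => t + Dt => /(_ Dt) H.
rewrite -(subrK (derive_in D g x * (t - x)) (g t - g x)).
rewrite (le_trans (ler_normD _ _))// normrM.
by move: H; rewrite mulrBl lerBrDr.
Qed.

Lemma derivable_in_continuous (D : set R) (g : R -> R) :
  (forall x, D x -> derivable_in D g x) -> {within D, continuous g}.
Proof.
move=> dg; apply/subspace_continuousP => x /dg dgx.
pose K := `|derive_in D g x| + 1.
have K0 : 0 < K by rewrite ltr_wpDl.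
have gK : \forall t \near x, D t -> `|g t - g x| <= K * `|t - x|.
  by apply: derive_in_lipschitz_near => //; rewrite ltrDl.
apply/cvgrPdistC_le => e e0; rewrite near_withinE.
near=> t => Dt.
have /le_trans -> // : `|g t - g x| <= K * `|t - x| by move: Dt; near: t; exact: gK.
rewrite mulrC -ler_pdivlMr//; near: t.
by apply: cvgr_distC_le; [exact: cvg_id|exact: divr_gt0].
Unshelve. all: by end_near. Qed.

(** Away from the single point [b], the derivative is a pointwise limit of forward difference
    quotients of the continuous function [g]. *)
Lemma measurable_derive_in (a b : R) (g : R -> R) :
    (forall x, x \in `[a, b] -> derivable_in `[a, b] g x) ->
  measurable_fun `[a, b] (derive_in `[a, b] g).
Proof.
move=> dg.
have mg : measurable_fun `[a, b] g.
  by apply: subspace_continuous_measurable_fun => //; exact: derivable_in_continuous.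
(* Truncation at [b] keeps the sample point in [[a, b]]; for fixed [x < b] it has no effect once [n]
   is large. *)
pose s n (x : R) := Num.min (x + n.+1%:R^-1) b.
apply/measurable_fun_itv_bndo_bndcP.
apply: (@measurable_fun_cvg _ _ _ _ (fun n x => (g (s n x) - g x) * n.+1%:R)).
  move=> n; apply: measurable_funM => //; apply: measurable_funB; last first.
    by apply: measurable_funS mg => //; exact: subset_itv_co_cc.
  apply: (measurable_comp (F := `[a, b]%classic)) => //.
    move=> _ [x /= + <-]; rewrite !in_itv/= => /andP[ax xb].
    by rewrite ge_min lexx orbT andbT le_min (le_trans ax (ltW xb)) andbT ler_wpDr.
  by apply: measurable_minr => //; exact: measurable_funD.
move=> x /=; rewrite in_itv/= => /andP[ax xb].
have xab : x \in `[a, b] by rewrite in_itv/= ax ltW.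
apply/cvgrPdistC_le => e e0.
have /nbhs_ballP[r /= r0 Hr] := derive_in_near (dg x xab) e0.
have bx : 0 < b - x by rewrite subr_gt0.
near=> n.
have nr : n.+1%:R^-1 < r by near: n; exact: (near_infty_natSinv_lt (PosNum r0)).
have nb : n.+1%:R^-1 < b - x by near: n; exact: (near_infty_natSinv_lt (PosNum bx)).
have sE : s n x = x + n.+1%:R^-1 by rewrite /s min_l// -lerBrDl ltW.
have := Hr (s n x); rewrite sE /ball/= opprD addNKr normrN ger0_norm// => /(_ nr).
rewrite in_itv/= (le_trans ax) ?lerDl//= -lerBrDl ltW// => /(_ isT).
rewrite [x + _]addrC addrK -(ler_pM2r (x := n.+1%:R))//.
rewrite -[X in _ * X <= _ -> _](ger0_norm (ler0n _ _)) -normrM mulrBl.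
by rewrite -!mulrA !mulVf// [`|_^-1|]ger0_norm// mulVf// !mulr1.
Unshelve. all: by end_near. Qed.

(** * Mean value and energy estimates *)

(** The function [g x - L * x] has derivative at most [e] in absolute value on [[p, q]], so the
    constant [e] serves as majorant. *)
Lemma derive_in_mean_value (a b p q L e : R) (g : R -> R) :
    a <= p -> p <= q -> q <= b ->
    (forall x, x \in `[a, b] -> derivable_in `[a, b] g x) ->
    (forall x, x \in `[p, q] -> `|derive_in `[a, b] g x - L| <= e) ->
  `|g q - g p - L * (q - p)| <= e * (q - p).
Proof.
move=> ap pq qb dg gL.
have sub x : x \in `[p, q] -> x \in `[a, b].
  by rewrite !in_itv/= => /andP[px xq]; rewrite (le_trans ap px) (le_trans xq).
have e0 : 0 <= e by apply: le_trans (gL p _); rewrite // in_itv/= lexx.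
rewrite -lee_fin; apply: le_trans (_ : (\int[mu]_(x in `[p, q]) e%:E <= _)%E).
  have -> : g q - g p - L * (q - p) = (g q - L * q) - (g p - L * p) by ring.
  apply: (@increment_le_integral _ _ (fun x => g x - L * x) (cst e)) => //.
  move=> x K xpq /= eK; have xab := sub x xpq.
  have := derive_in_near (dg x xab) (e := K - e); rewrite subr_gt0 => /(_ eK).
  apply: filterS => t Ht tpq; have {}Ht := Ht (sub t tpq).
  have -> : g t - L * t - (g x - L * x) = (g t - g x - derive_in `[a, b] g x * (t - x)) +
    (derive_in `[a, b] g x - L) * (t - x) by ring.
  apply: le_trans (ler_normD _ _) _; rewrite normrM.
  have := ler_wpM2r (normr_ge0 (t - x)) (gL x xpq).
  by lra.
rewrite (integral_cst mu _ e%:E)//= lebesgue_measure_itv/= lte_fin.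
by case: ltgtP pq => // -> _; rewrite subrr mulr0 mule0.
Qed.

(** A linearized Cauchy-Schwarz estimate; [c] stays free so that it can be adapted to the desired
    accuracy. *)
Lemma derive_in_energy_bound (a b x t c M : R) (g : R -> R) :
    (forall x, x \in `[a, b] -> derivable_in `[a, b] g x) ->
    (\int[mu]_(x in `[a, b]) (derive_in `[a, b] g x ^+ 2)%:E <= M%:E)%E ->
    0 < c -> a <= x -> x <= t -> t <= b ->
  `|g t - g x| <= c * (t - x) / 2 + M / (c * 2).
Proof.
move=> dg gM c0 ax xt tb; pose d := derive_in `[a, b] g.
have sub : `[x, t] `<=` `[a, b].
  by apply: subset_itv; rewrite bnd_simp.
have md : measurable_fun `[a, b] d by exact: measurable_derive_in.
have mdx : measurable_fun `[x, t] d by exact: measurable_funS md.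
pose u s := c / 2 + (c * 2)^-1 * d s ^+ 2.
have k0 : 0 < (c * 2)^-1 by rewrite invr_gt0 mulr_gt0.
(* AM-GM *)
have du s : `|d s| <= u s.
  have -> : u s = `|d s| + (c * 2)^-1 * (c - `|d s|) ^+ 2.
    by rewrite /u -[d s ^+ 2]real_normK ?num_real//; field; rewrite gt_eqF.
  by rewrite lerDl mulr_ge0 ?sqr_ge0 ?ltW.
have md2 : measurable_fun `[x, t] (fun s => (d s ^+ 2)%:E).
  by apply/measurable_EFinP; exact: measurable_funX.
rewrite -lee_fin; apply: le_trans (_ : (\int[mu]_(s in `[x, t]) (u s)%:E <= _)%E).
  apply: increment_le_integral => //.
  - apply: measurable_funD => //; apply: measurable_funM => //.
    exact: measurable_funX.
  - by move=> s _; exact: le_trans (du s).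
  - move=> s K sxt uK; have sab := sub s sxt.
    have := derive_in_lipschitz_near (dg s sab) (le_lt_trans (du s) uK).
    by apply: filterS => r + rxt; apply; exact: sub.
under eq_integral do rewrite EFinD [X in (_ + X)%E]EFinM.
rewrite ge0_integralD//; last 3 first.
  by move=> s _; rewrite lee_fin divr_ge0// ltW.
  by move=> s _; rewrite mule_ge0// lee_fin ?sqr_ge0// ltW.
  exact: measurable_funeM.
rewrite EFinD leeD//.
  rewrite (integral_cst mu _ (c / 2)%:E)//= lebesgue_measure_itv/= lte_fin.
  case: ltgtP xt => // [_ _|-> _]; last by rewrite subrr mulr0 mul0r mule0.
  by rewrite -EFinB -EFinM mulrAC.
rewrite ge0_integralZl//; last 2 first.
  by move=> s _; rewrite lee_fin sqr_ge0.
  by rewrite lee_fin ltW.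
rewrite [M / _]mulrC EFinM lee_pmul2l// ?lte_fin//.
apply: le_trans gM; apply: ge0_subset_integral => //.
  by apply/measurable_EFinP; exact: measurable_funX.
by move=> s _; rewrite lee_fin sqr_ge0.
Qed.

End PointwiseDerivative.

(** * Equicontinuity in [x] and joint continuity *)

Theorem corollary2p3 (R : realType) (Y : set R) (f : R -> R -> R)
  (f_cont_y : forall x : R, x \in `[0, 1] -> {within Y, continuous (f x)})
  (f_xx : forall x y : R, x \in `[0, 1] -> Y y -> partial_xx_exists f x y)
  (f_sup : (ereal_sup [set (\int[@lebesgue_measure R]_(x in `[0%R, 1%R])
                              ((partial_xx f x y) ^+ 2)%:E)%E | y in Y]
            < +oo)%E) :
  {within `[0, 1] `*` Y, continuous (fun z : R * R => partial_x f z.1 z.2)}.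
Proof.
have [M M0 fM] : exists2 M : R, 0 < M & forall y, Y y ->
    (\int[@lebesgue_measure R]_(x in `[0%R, 1%R]) ((partial_xx f x y) ^+ 2)%:E <= M%:E)%E.
  set s := ereal_sup _ in f_sup.
  (* The maximum with [1] makes [M] positive, since [equi] divides by it. *)
  exists (Num.max 1 (fine s)); first by rewrite lt_max ltr01.
  move=> y Yy; apply: (@le_trans _ _ s).
    by apply: ereal_sup_ubound; exists y.
  by case: s f_sup => [r||]//= _; rewrite ?leNye// lee_fin le_max lexx orbT.
have dfx x y : x \in `[0, 1] -> Y y -> derivable_in `[0, 1] (f ^~ y) x.
  by move=> x01 Yy; have [+ _] := f_xx x y x01 Yy; exact.
(* With [c = M / e] and [|x - t| < e / c], both terms of the energy bound are at
   most [e / 2], uniformly in [y]. *)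
have equi e : 0 < e -> exists2 d : R, 0 < d & forall x t y, x \in `[0, 1] ->
    t \in `[0, 1] -> Y y -> `|x - t| < d ->
    `|partial_x f x y - partial_x f t y| <= e.
  move=> e0; exists (e ^+ 2 / M); first by rewrite divr_gt0// exprn_gt0.
  move=> x t y; wlog xt : x t / x <= t => [H|].
    move=> x01 t01 Yy; have [xt|/ltW tx] := leP x t; first exact: H.
    by move=> xt; rewrite distrC; apply: H => //; rewrite distrC.
  rewrite !in_itv/= => /andP[x0 _] /andP[_ t1] Yy xte.
  rewrite distrC.
  have dg z : z \in `[0, 1] -> derivable_in `[0, 1] (partial_x f ^~ y) z.
    by move=> z01; have [_] := f_xx z y z01 Yy.
  have c0 : 0 < M / e by rewrite divr_gt0.
  have /le_trans -> // := derive_in_energy_bound dg (fM y Yy) c0 x0 xt t1.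
  move: xte; rewrite distrC ger0_norm ?subr_ge0// => xte.
  have -> : M / (M / e * 2) = e / 2 by field; rewrite !gt_eqF.
  have : M / e * (t - x) <= e.
    rewrite mulrAC ler_pdivrMr// mulrC -ler_pdivlMr//.
    by rewrite -expr2 ltW.
  by lra.
apply/subspace_continuousP => -[x0 y0] [/= x01 Yy0].
apply/cvgrPdist_le => e e0; rewrite near_withinE /=.
have e4 : 0 < e / 4 by rewrite divr_gt0.
have [d d0 Hd] := equi _ e4.
(* Cutting [[x0 - d / 2, x0 + d / 2]] down to [[0, 1]] leaves positive length even if [x0] is an
   endpoint. The same [p] and [q] serve every [y]. *)
have [p [q [pq p0 q1 pqd]]] : exists p q : R,
    [/\ p < q, 0 <= p, q <= 1 & forall x, x \in `[p, q] -> `|x - x0| < d].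
  exists (Num.max 0 (x0 - d / 2)), (Num.min 1 (x0 + d / 2)).
  move: x01; rewrite in_itv/= => /andP[x00 x01]; split.
  - rewrite lt_min !gt_max ltr01/=.
    by apply/and3P; split; lra.
  - by rewrite le_max lexx.
  - by rewrite ge_min lexx.
  - move=> x; rewrite in_itv/= ge_max le_min => /andP[/andP[_ h1] /andP[_ h2]].
    by rewrite ltr_norml; lra.
have p01 : p \in `[0, 1] by rewrite in_itv/= p0 (le_trans (ltW pq)).
have q01 : q \in `[0, 1] by rewrite in_itv/= q1 (le_trans p0 (ltW pq)).
have qp : 0 < q - p by rewrite subr_gt0.
pose S y := (f q y - f p y) / (q - p).
(* By equicontinuity [f'_x] stays within [e / 4] of its value at [x0] along [[p, q]], hence so does
   its mean slope [S y]. *)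
have Sf y : Y y -> `|S y - partial_x f x0 y| <= e / 4.
  move=> Yy; rewrite -(ler_pM2r qp) -{1}(gtr0_norm qp) -normrM mulrBl divfK ?gt_eqF//.
  apply: (derive_in_mean_value (g := f ^~ y) p0 (ltW pq) q1) => [x x01'|x xpq].
    exact: dfx.
  apply: Hd => //; last exact: pqd.
  by move: xpq; rewrite !in_itv/= => /andP[px xq]; rewrite (le_trans p0 px) (le_trans xq).
(* Only the two sections [f p] and [f q] enter [S], so continuity in [y] suffices. *)
have Scvg : \forall y \near y0, Y y -> `|S y0 - S y| <= e / 4.
  have cS : S y @[y --> within Y (nbhs y0)] --> S y0.
    have /subspace_continuousP/(_ _ Yy0) cq := f_cont_y q q01.
    have /subspace_continuousP/(_ _ Yy0) cp := f_cont_y p p01.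
    by apply: cvgM; [exact: cvgB|exact: cvg_cst].
  by have /cvgrPdist_le/(_ _ e4) := cS; rewrite near_withinE.
have xcvg : \forall z \near (x0, y0), `|z.1 - x0| < d.
  have /cvgrPdistC_lt/(_ _ d0) : z.1 @[z --> (x0, y0)] --> x0 by exact: cvg_fst.
  exact.
have ycvg : \forall z \near (x0, y0), Y z.2 -> `|S y0 - S z.2| <= e / 4.
  exact: (cvg_snd Scvg).
(* Four steps of [e / 4] link [f'_x] at [(x0, y0)] to [S y0], [S z.2], [f'_x] at [(x0, z.2)] and
   finally [f'_x] at [z]. *)
near=> z => -[/= z1 Yz].
have h1 : `|S y0 - S z.2| <= e / 4 by move: Yz; near: z; exact: ycvg.
have h2 : `|partial_x f z.1 z.2 - partial_x f x0 z.2| <= e / 4.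
  by apply: Hd => //; near: z; exact: xcvg.
have h3 := Sf _ Yy0; have h4 := Sf _ Yz.
by move: h1 h2 h3 h4; rewrite /from_subspace/= !ler_norml; lra.
Unshelve. all: by end_near. Qed.
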